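(* Suppose either (a) $c+1\geq a\geq c>0$ and $\{h_n\}_{n=0}^{\infty}$ is an arbitrary nonnegative sequence, or (b) $c>0$, $a\in(0,c)\cup(c+1,\infty)$ and $\{h_n\}_{n=0}^{\infty}$ is a nonnegative log-concave sequence without internal zeros. Let $$h_{a,c}(\mu;x)=\sum_{n=0}^{\infty}h_n\frac{(a+\mu)_n}{\Gamma(c+\mu+n)}\frac{x^n}{n!},\qquad \lambda_{a,c}(\mu,\nu;x)=h_{a,c}(\mu;x)h_{a,c}(\nu;x)-h_{a,c}(0;x)h_{a,c}(\mu+\nu;x).$$ Then $\mu\mapsto h_{a,c}(\mu;x)$ is discrete Wright log-concave on $[0,\infty)$ for each fixed $x>0$. Moreover, the family $\{h_{a,c}(\mu;x)\}_{\mu\geq0}$ is discrete $q$-log-concave, i.e. $\lambda_{a,c}(\mu,\nu;x)$ has nonnegative power series coefficients (in powers of $x$) for $\nu\in\mathbb{N}$, $\mu\geq\nu-1$, so that for such $\mu,\nu$ the function $x\mapsto\lambda_{a,c}(\mu,\nu;x)$ is absolutely monotonic and multiplicatively convex on $(0,\infty)$.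
   Context: $\mathbb{N}$ is the set of positive integers; $(a)_0=1$, $(a)_n=a(a+1)\cdots(a+n-1)$ is the rising factorial. A nonnegative sequence $\{h_n\}_{n\ge0}$ is log-concave if $h_n^2\ge h_{n-1}h_{n+1}$ for all $n\ge1$; it has no internal zeros if $h_N=0$ implies that either $h_{N+i}=0$ for all $i\ge0$ or $h_{N-i}=0$ for $i=0,1,\dots,N$; log-concave sequences are also assumed non-trivial (not identically zero). A function $F:[0,\infty)\to[0,\infty)$ is discrete Wright log-concave if $F(\mu+\alpha)F(\mu+\beta)\ge F(\mu)F(\mu+\alpha+\beta)$ for all $\alpha\in\mathbb{N}$ and all $\mu,\beta\ge0$. A family $\{f(\mu;x)\}_{\mu\ge0}$ of formal power series in $x$ whose coefficients are nonnegative continuous functions of $\mu$ is discrete $q$-log-concave if $f(\mu+\alpha;x)f(\mu+\beta;x)-f(\mu;x)f(\mu+\alpha+\beta;x)$ has nonnegative coefficients at all powers of $x$ for all $\alpha\in\mathbb{N}$, $\beta\ge\alpha-1$ and $\mu\ge0$. A function is absolutely monotonic on an interval if it and all its derivatives are nonnegative there. A nonnegative function $\phi$ is multiplicatively convex if $\phi(x^{t}y^{1-t})\le\phi(x)^{t}\phi(y)^{1-t}$ for all $x,y$ in the interval and $t\in[0,1]$. Power series are understood as formal; assertions about values at fixed $x$, or about functions of $x$ on $(0,\infty)$, are understood for those $x>0$ in the interval of convergence of the series. *)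

(* Defs.v *)
From mathcomp Require Export all_boot all_order all_algebra.
From mathcomp Require Export all_classical all_reals all_analysis.
Set Implicit Arguments.
Unset Strict Implicit.
Unset Printing Implicit Defensive.
Export Order.TTheory GRing.Theory Num.Theory.
Export numFieldNormedType.Exports.

Local Open Scope classical_set_scope.
Local Open Scope ring_scope.

(* Only used at s > 0, where the integral converges. *)
Definition Gamma {R : realType} (s : R) : R :=
  \int[lebesgue_measure]_(t in `]0, +oo[) (t `^ (s - 1) * expR (- t)).

Definition rising {R : realType} (a : R) (n : nat) : R :=
  \prod_(i < n) (a + i%:R).

Definition log_concave {R : realType} (h : nat -> R) : Prop :=
  [/\ forall n, 0 <= h n,
      forall n, (1 <= n)%N -> h n.-1 * h n.+1 <= h n ^+ 2 &
      exists n, h n != 0].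

Definition no_internal_zeros {R : realType} (h : nat -> R) : Prop :=
  forall N, h N = 0 ->
    (forall i, h (N + i)%N = 0) \/ (forall i, (i <= N)%N -> h (N - i)%N = 0).

(* A function on [0, +oo) is encoded by a total function that is only
   constrained at nonnegative arguments. *)
Definition discrete_Wright_log_concave {R : realType} (F : R -> R) : Prop :=
  (forall mu, 0 <= mu -> 0 <= F mu) /\
  forall (alpha : nat) (mu beta : R), (0 < alpha)%N -> 0 <= mu -> 0 <= beta ->
    F mu * F (mu + alpha%:R + beta) <= F (mu + alpha%:R) * F (mu + beta).

(* A formal power series is encoded by its sequence of coefficients; this is
   the Cauchy product. *)
Definition fps_mul {R : realType} (f g : nat -> R) (n : nat) : R :=
  \sum_(k < n.+1) f k * g (n - k)%N.

(* f mu n is the coefficient of x ^ n in f(mu; x). *)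
Definition discrete_q_log_concave {R : realType} (f : R -> nat -> R) : Prop :=
  [/\ forall n mu, 0 <= mu -> 0 <= f mu n,
      forall n, {within `[0, +oo[, continuous (fun mu => f mu n)} &
      forall (alpha : nat) (beta mu : R),
        (0 < alpha)%N -> alpha%:R - 1 <= beta -> 0 <= mu ->
        forall n, 0 <= fps_mul (f (mu + alpha%:R)) (f (mu + beta)) n
                       - fps_mul (f mu) (f (mu + alpha%:R + beta)) n].

(* Derivatives are two-sided, hence required at interior points only; on an
   open interval this is the usual definition. *)
Definition absolutely_monotonic_on {R : realType} (I : set R) (f : R -> R)
    : Prop :=
  (forall x, I x -> 0 <= f x) /\
  forall n x, interior I x -> derivable (derive1n n f) x 1 /\ 0 <= derive1n n f x.

Definition multiplicatively_convex_on {R : realType} (I : set R) (f : R -> R)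
    : Prop :=
  (forall x, I x -> 0 <= f x) /\
  forall x y t, I x -> I y -> 0 <= t <= 1 ->
    f (x `^ t * y `^ (1 - t)) <= f x `^ t * f y `^ (1 - t).

Definition hcoef {R : realType} (a c : R) (h : nat -> R) (mu : R) (n : nat)
    : R :=
  h n * (rising (a + mu) n / Gamma (c + mu + n%:R)) / n`!%:R.

Definition hfun {R : realType} (a c : R) (h : nat -> R) (mu x : R) : R :=
  limn (pseries (hcoef a c h mu) x).

Definition lambda_coef {R : realType} (a c : R) (h : nat -> R) (mu nu : R)
    (n : nat) : R :=
  fps_mul (hcoef a c h mu) (hcoef a c h nu) n
  - fps_mul (hcoef a c h 0) (hcoef a c h (mu + nu)) n.

Definition lambda_fun {R : realType} (a c : R) (h : nat -> R) (mu nu x : R)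
    : R :=
  hfun a c h mu x * hfun a c h nu x - hfun a c h 0 x * hfun a c h (mu + nu) x.

(* The positive x in the intervals of convergence of the four series occurring
   in lambda_fun: an interval with left endpoint 0, possibly empty, bounded or
   unbounded, and possibly closed on the right. *)
Definition lambda_dom {R : realType} (a c : R) (h : nat -> R) (mu nu : R)
    : set R :=
  [set x | 0 < x /\
     forall s, s \in [:: mu; nu; 0; mu + nu] ->
       cvgn (pseries (hcoef a c h s) x)].

(* Main.v *)
Require Import Defs.
From mathcomp Require Import measurable_realfun ring lra.
Set Implicit Arguments.
Unset Strict Implicit.
Unset Printing Implicit Defensive.
Local Open Scope classical_set_scope.
Local Open Scope ring_scope.

(** Write the coefficient of [x ^ n] in [h_{a,c}(mu; x)] as [g n * P n], where
    [g n = h n / n!] and [P n = (a + mu)_n / Gamma (c + mu + n)].  Both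
    log-concavity claims come from the unit shift
      [f(mu + 1) f(mu + t) - f(mu) f(mu + 1 + t) >= 0], [t >= 0],
    read coefficientwise.  For series, a shift by [nu] is a chain of unit shifts
    whose gaps stay nonnegative exactly when [mu >= nu - 1]
    ([hcoef_shift_le]); for values at a fixed [x], the unit shift says that
    [f(mu + 1; x) / f(mu; x)] is monotone, and quotients may be multiplied
    without any restriction on the gap ([unit_steps_Wright]).

    Raising [mu] by 1 turns [P n] into [P (n + 1)] divided by [a + mu].  Let [Q]
    be the analogue of [P] for [mu + t].  Up to a positive factor, and with [a],
    [c] for [a + mu], [c + mu], the coefficient to be bounded is thus
      [sum_(i + j = n) g i g j ((a + t) P (i + 1) Q j - a P i Q (j + 1))].
    Its sign is decided by pairing the terms at [(i, j)] and [(j, i)], together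
    with the monotonicity of [Q / P], which is governed by the sign of [a - c]
    ([ratio_sequence_cross]):
    - if [c <= a] and [h] is log-concave, an index shift and the rearrangement
      inequality suffice ([unit_shift_coef_ge0_large]);
    - if [a <= c] and [h] is log-concave, the sum is first rewritten by a
      discrete integration by parts ([unit_shift_coef_ge0_small]);
    - if [c <= a <= c + 1], every pair is nonnegative for arbitrary [h]
      ([unit_shift_coef_ge0_middle]).

    The Gamma function contributes its positivity, its functional equation and
    its continuity, all derived from the integral.  The claims about functions
    of [x] hold for any power series with nonnegative coefficients: termwise
    differentiation gives absolute monotonicity and Hoelder's inequality gives
    multiplicative convexity; the Cauchy product identifies [lambda] as the sum
    of such a series. *)

(** * Sums over antidiagonals and log-concave sequences *)

(** Adding the sum to its own reversal pairs [T i j] with [T j i]. *)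
Lemma sum_symmetrized_ge0 (R : realFieldType) (T : nat -> nat -> R) (n : nat) :
  (forall i j, (i <= j)%N -> (i + j = n)%N -> 0 <= T i j + T j i) ->
  0 <= \sum_(k < n.+1) T k (n - k)%N.
Proof.
move=> T_ge0; set S := \sum_(k < _) _.
suff: 0 <= S + S by lra.
rewrite {2}/S (reindex_inj rev_ord_inj) /= /S -big_split /= sumr_ge0 // => k _.
have kn : (k <= n)%N by rewrite -ltnS.
rewrite subSS subKn //; case: (leqP k (n - k)) => knk.
  by rewrite T_ge0 ?subnKC.
by rewrite addrC T_ge0 ?subnK // ltnW.
Qed.

(** Two sums over [i + j = n], one raising the first index and the other the
    second, become a single sum over [i + j = n + 1]; the missing end terms are
    the ones assumed to vanish. *)
Lemma sum_antidiagonal_shift (R : realFieldType) (F G : nat -> nat -> R) n :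
  F 0%N n.+1 = 0 -> G n.+1 0%N = 0 ->
  \sum_(k < n.+1) (F k.+1 (n - k)%N + G k (n - k).+1)
  = \sum_(k < n.+2) (F k (n.+1 - k)%N + G k (n.+1 - k)%N).
Proof.
move=> F0 G0; rewrite !big_split /=; congr (_ + _).
  by rewrite [RHS]big_ord_recl /= subn0 F0 add0r; apply: eq_bigr.
rewrite [RHS]big_ord_recr /= subnn G0 addr0; apply: eq_bigr => k _.
by rewrite subSn // -ltnS.
Qed.

Lemma ratio_nondecreasing_cross (R : realFieldType) (p q : nat -> R) :
  (forall i, 0 < p i) -> (forall i, 0 < q i) ->
  (forall i, p i.+1 * q i <= p i * q i.+1) ->
  forall i j, (i <= j)%N -> p j * q i <= p i * q j.
Proof.
move=> p0 q0 step i j ij.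
have mono : {homo (fun k => q k / p k) : k l / (k <= l)%N >-> k <= l}.
  apply: homo_leq => [//||k]; first exact: le_trans.
  by rewrite ler_pdivrMr // mulrAC ler_pdivlMr // mulrC [leRHS]mulrC step.
have := mono _ _ ij; rewrite ler_pdivrMr // mulrAC ler_pdivlMr //.
by rewrite mulrC [q j * _]mulrC.
Qed.

(** The ratio form [h (i + 1) / h i >= h (j + 1) / h j] of log-concavity, with
    the denominators cleared so that zeros are harmless. *)
Definition nonincreasing_ratios (R : realFieldType) (h : nat -> R) :=
  forall i j, (i <= j)%N -> h i * h j.+1 <= h i.+1 * h j.

(** Consecutive instances of [h (k + 1) ^ 2 >= h k * h (k + 2)] can be
    multiplied as long as the intermediate values are nonzero; if one of them
    vanishes, the absence of internal zeros makes the left-hand side vanish. *)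
Lemma log_concave_nonincreasing_ratios (R : realType) (h : nat -> R) :
  log_concave h -> no_internal_zeros h -> nonincreasing_ratios h.
Proof.
move=> [h0 hlc _] hz i j /subnK <-.
elim: (j - i)%N => [|m]; first by rewrite add0n mulrC.
rewrite addSn; set k := (m + i)%N => IH.
have ik : (i <= k)%N by rewrite leq_addl.
have zero : h k = 0 -> h i * h k.+2 = 0.
  move=> /hz[after|before]; first by rewrite -[k.+2]addn2 after mulr0.
  by rewrite -(subKn ik) before ?mul0r ?leq_subr.
have [hk|hk] := eqVneq (h k) 0; first by rewrite zero ?mulr_ge0.
have {}hk : 0 < h k by rewrite lt_neqAle eq_sym hk h0.
have [hk1|hk1] := eqVneq (h k.+1) 0.
  have [after|before] := hz _ hk1.
    by rewrite -[k.+2]addn1 after mulr0 mulr_ge0.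
  by rewrite -(subKn (leqW ik)) before ?mul0r ?mulr_ge0 ?leq_subr.
rewrite -(ler_pM2r hk) -mulrA [h k.+2 * _]mulrC.
apply: le_trans (ler_wpM2l (h0 i) (hlc k.+1 isT)) _ => /=.
by rewrite expr2 mulrA [leRHS]mulrAC ler_wpM2r.
Qed.

(** * The coefficient inequality for a unit shift *)

(** The sequences [k |-> (a)_k / Gamma (c + k)], up to a positive factor.  Only
    this recurrence is used in the coefficient estimates, so that the Gamma
    function enters through its functional equation alone. *)
Definition ratio_sequence (R : realFieldType) (a c : R) (P : nat -> R) :=
  (forall k, 0 < P k) /\
  forall k, (c + k%:R) * P k.+1 = (a + k%:R) * P k.

(** The quotient of consecutive terms of [Q / P] is
    [(b + k) (c + k) / ((a + k) (d + k))].  As [a + d = b + c], numerator minus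
    denominator is [b c - a d], whatever [k] is, so [Q / P] is monotone. *)
Lemma ratio_sequence_cross (R : realFieldType) (a c b d : R) P Q :
  0 < c -> 0 < d -> a + d = b + c -> a * d <= b * c ->
  ratio_sequence a c P -> ratio_sequence b d Q ->
  forall i j, (i <= j)%N -> P j * Q i <= P i * Q j.
Proof.
move=> c0 d0 abcd adbc [P0 PS] [Q0 QS] i j.
apply: ratio_nondecreasing_cross => // k.
have k0 : 0 <= k%:R :> R by [].
have ck : 0 < c + k%:R by lra.
have dk : 0 < d + k%:R by lra.
rewrite -(ler_pM2l ck) -(ler_pM2l dk).
have -> : (d + k%:R) * ((c + k%:R) * (P k * Q k.+1))
  = (b + k%:R) * (c + k%:R) * (P k * Q k).
  by rewrite mulrCA mulrACA -mulrA [_ * (_ * Q k.+1)]mulrCA QS; ring.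
have -> : (d + k%:R) * ((c + k%:R) * (P k.+1 * Q k))
  = (a + k%:R) * (d + k%:R) * (P k * Q k).
  by rewrite [(c + _) * _]mulrA PS; ring.
rewrite (ler_pM2r (mulr_gt0 (P0 k) (Q0 k))).
have : b = a + d - c by rewrite abcd addrK.
move: adbc => /[swap] -> adbc; lra.
Qed.

(** The coefficients of [x * g(x)], where [g(x)] has the coefficients [g]. *)
Definition pred_coef (R : realFieldType) (g : nat -> R) (n : nat) : R :=
  if n is m.+1 then g m else 0.

Lemma pred_coef_ge0 (R : realFieldType) (g : nat -> R) :
  (forall i, 0 <= g i) -> forall i, 0 <= pred_coef g i.
Proof. by move=> g0 [|i] /=. Qed.

(** The case [c <= a].  After shifting, the terms at [(x, y)] and [(y, x)] with
    [x <= y] and [x + y = n + 1] add up to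
    [(a + t) (p X + q Y) - a (q X + p Y)], where
    [q = P x * Q y <= p = P y * Q x] and
    [Y = g (x - 1) * g y <= X = g x * g (y - 1)].  The rearrangement inequality
    [q X + p Y <= p X + q Y] concludes. *)
Lemma unit_shift_coef_ge0_large (R : realFieldType) (a c t : R)
    (P Q g : nat -> R) n :
  0 < a -> 0 < c -> 0 <= t -> c <= a ->
  ratio_sequence a c P -> ratio_sequence (a + t) (c + t) Q ->
  (forall i, 0 <= g i) ->
  (forall i j, (i <= j)%N -> pred_coef g i * g j <= g i * pred_coef g j) ->
  0 <= \sum_(k < n.+1) g k * g (n - k)%N *
    ((a + t) * (P k.+1 * Q (n - k)%N) - a * (P k * Q (n - k).+1)).
Proof.
move=> a0 c0 t0 ca rP rQ g0 gpg; have [P0 _] := rP; have [Q0 _] := rQ.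
pose F x y := (a + t) * (pred_coef g x * g y) * (P x * Q y).
pose G x y := - a * (g x * pred_coef g y) * (P x * Q y).
rewrite (eq_bigr (fun k : 'I_n.+1 => F k.+1 (n - k)%N + G k (n - k).+1)).
  rewrite sum_antidiagonal_shift; [|by rewrite /F /= mul0r mulr0 mul0r|
    by rewrite /G /= !mulr0 mul0r].
  apply: (sum_symmetrized_ge0 (T := fun x y => F x y + G x y)) => x y xy _.
  have pq : P x * Q y <= P y * Q x.
    rewrite mulrC [leRHS]mulrC; move: x y xy.
    by apply: (ratio_sequence_cross _ _ _ _ rQ rP); nra.
  have X0 : 0 <= g x * pred_coef g y by rewrite mulr_ge0 ?pred_coef_ge0.
  have q0 : 0 <= P x * Q y by rewrite mulr_ge0 ?ltW.
  have XY := gpg _ _ xy.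
  have Y0 : 0 <= pred_coef g x * g y by rewrite mulr_ge0 ?pred_coef_ge0.
  have -> : F x y + G x y + (F y x + G y x) =
    a * ((P y * Q x - P x * Q y) *
           (g x * pred_coef g y - pred_coef g x * g y)) +
    t * (P x * Q y * (pred_coef g x * g y) + P y * Q x * (g x * pred_coef g y)).
    by rewrite /F /G; ring.
  apply: addr_ge0; first by rewrite mulr_ge0 ?(ltW a0) // mulr_ge0 ?subr_ge0.
  by rewrite mulr_ge0 // addr_ge0 // mulr_ge0 // (le_trans q0).
by move=> k _; rewrite /F /G /=; ring.
Qed.

(** The case [a <= c], where [P j * Q i <= P i * Q j] for [i <= j]: the
    rearrangement inequality now points the wrong way.  The two recurrences
    give, with [i + j = n],
    [(a + t) P (i + 1) Q j - a P i Q (j + 1)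
       = (t + j - i) P (i + 1) Q (j + 1) - (j P (i + 1) Q j - i P i Q (j + 1))],
    the discrete trace of an integration by parts for the Beta integral
    representation of the series, valid for [a < c].  The two parts are paired
    separately, the second one after an index shift; apart from the nonnegative terms with
    factor [t], each pair yields a product of two differences of the same
    sign. *)
Lemma unit_shift_coef_ge0_small (R : realFieldType) (a c t : R)
    (P Q g : nat -> R) n :
  0 < a -> 0 < c -> 0 <= t -> a <= c ->
  ratio_sequence a c P -> ratio_sequence (a + t) (c + t) Q ->
  (forall i, 0 <= g i) ->
  (forall i j, (i <= j)%N ->
     j%:R * (pred_coef g i * g j) <= i%:R * (g i * pred_coef g j)) ->
  0 <= \sum_(k < n.+1) g k * g (n - k)%N *
    ((a + t) * (P k.+1 * Q (n - k)%N) - a * (P k * Q (n - k).+1)).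
Proof.
move=> a0 c0 t0 ac rP rQ g0 gpg; have [P0 PS] := rP; have [Q0 QS] := rQ.
have cross : forall i j, (i <= j)%N -> P j * Q i <= P i * Q j.
  by apply: (ratio_sequence_cross _ _ _ _ rP rQ); nra.
pose S x y := (t + y%:R - x%:R) * (g x * g y) * (P x.+1 * Q y.+1).
pose F x y := - y%:R * (pred_coef g x * g y) * (P x * Q y).
pose G x y := x%:R * (g x * pred_coef g y) * (P x * Q y).
(* [S] is the summand with both indices raised; [F + G] is the rest. *)
rewrite (eq_bigr (fun k : 'I_n.+1 =>
  S k (n - k)%N + (F k.+1 (n - k)%N + G k (n - k).+1))).
  rewrite big_split /=; apply: addr_ge0.
    apply: sum_symmetrized_ge0 => i j ij _.
    have := cross i.+1 j.+1 ij.
    have p0 : 0 <= P j.+1 * Q i.+1 by rewrite mulr_ge0 ?ltW.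
    have -> : S i j + S j i = g i * g j *
      (t * (P i.+1 * Q j.+1 + P j.+1 * Q i.+1)
      + (j%:R - i%:R) * (P i.+1 * Q j.+1 - P j.+1 * Q i.+1)).
      by rewrite /S; ring.
    move=> pq; rewrite mulr_ge0 ?mulr_ge0 // addr_ge0 ?mulr_ge0 ?subr_ge0 //.
      by rewrite addr_ge0 // (le_trans p0).
    by rewrite ler_nat.
  rewrite sum_antidiagonal_shift; [|by rewrite /F /= mul0r mulr0 mul0r|
    by rewrite /G /= !mulr0 mul0r].
  apply: (sum_symmetrized_ge0 (T := fun x y => F x y + G x y)) => x y xy _.
  have -> : F x y + G x y + (F y x + G y x) =
    (x%:R * (g x * pred_coef g y) - y%:R * (pred_coef g x * g y)) *
    (P x * Q y - P y * Q x) by rewrite /F /G; ring.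
  by rewrite mulr_ge0 ?subr_ge0 ?cross ?gpg.
move=> k _; rewrite /S /F /G /=; set j := (n - k)%N.
have := PS k; have := QS j.
set p := P k; set p' := P k.+1; set q := Q j; set q' := Q j.+1 => qE pE.
have -> : (a + t) * (p' * q) - a * (p * q') =
  p' * ((a + t + j%:R) * q) - ((a + k%:R) * p) * q' - j%:R * (p' * q)
  + k%:R * (p * q') by ring.
by rewrite -qE -pE; ring.
Qed.

(** The case [c <= a <= c + 1].  The weights [g i * g j] are arbitrary, so the
    terms at [(i, j)] and [(j, i)] must already have a nonnegative sum.  Each is
    a positive factor [p i * q j] times a polynomial [N i j], where
    [p k = P k / (c + k)] solves the recurrence with [c] replaced by [c + 1].
    Since [a <= c + 1] this reverses the monotonicity of the quotient: the
    possibly negative [N j i] carries the smaller factor, and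
    [N i j + N j i >= 0] by expansion. *)
Lemma unit_shift_coef_ge0_middle (R : realFieldType) (a c t : R)
    (P Q g : nat -> R) n :
  0 < c -> 0 <= t -> c <= a <= c + 1 ->
  ratio_sequence a c P -> ratio_sequence (a + t) (c + t) Q ->
  (forall i, 0 <= g i) ->
  0 <= \sum_(k < n.+1) g k * g (n - k)%N *
    ((a + t) * (P k.+1 * Q (n - k)%N) - a * (P k * Q (n - k).+1)).
Proof.
move=> c0 t0 /andP[ca ac] rP rQ g0; have [P0 PS] := rP; have [Q0 QS] := rQ.
have ck k : 0 < c + k%:R by rewrite ltr_wpDr.
have dk k : 0 < c + t + k%:R by rewrite ltr_wpDr ?ltr_wpDr.
pose p k := P k / (c + k%:R); pose q k := Q k / (c + t + k%:R).
have pE k : P k = (c + k%:R) * p k by rewrite mulrC divfK ?gt_eqF.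
have qE k : Q k = (c + t + k%:R) * q k by rewrite mulrC divfK ?gt_eqF.
have PSE k : P k.+1 = (a + k%:R) * p k.
  by apply: (mulfI (lt0r_neq0 (ck k))); rewrite PS pE; ring.
have QSE k : Q k.+1 = (a + t + k%:R) * q k.
  by apply: (mulfI (lt0r_neq0 (dk k))); rewrite QS qE; ring.
have p0 k : 0 < p k by rewrite divr_gt0.
have q0 k : 0 < q k by rewrite divr_gt0.
have cross : forall i j, (i <= j)%N -> p j * q i <= p i * q j.
  apply: (@ratio_sequence_cross _ a (c + 1) (a + t) (c + t + 1));
    [lra|lra|lra|nra| |].
    by split=> // k; rewrite -PSE pE -natr1; ring.
  by split=> // k; rewrite -QSE qE -natr1; ring.
pose W i j := (a + t) * (P i.+1 * Q j) - a * (P i * Q j.+1).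
apply: (sum_symmetrized_ge0 (T := fun i j => g i * g j * W i j)) => i j ij _.
rewrite [g j * _]mulrC -mulrDr mulr_ge0 ?mulr_ge0 //.
pose N i j := t * (a + i%:R) * (a + t + j%:R)
  + (a - c) * (j%:R * a - i%:R * (a + t)).
have WE x y : W x y = p x * q y * N x y.
  by rewrite /W /N PSE QSE pE qE; ring.
have i0 : 0 <= i%:R :> R by [].
have ijR : i%:R <= j%:R :> R by rewrite ler_nat.
have NN : 0 <= N i j + N j i.
  have -> : N i j + N j i = t * ((a + i%:R) * (a + t + j%:R) +
    (a + j%:R) * (a + t + i%:R) - (a - c) * (i%:R + j%:R)).
    by rewrite /N; ring.
  rewrite mulr_ge0 //.
  have a0 : 0 <= a by lra.
  have j0 : 0 <= j%:R :> R by [].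
  have := mulr_ge0 (ltW c0) (addr_ge0 i0 j0).
  have := mulr_ge0 i0 j0; have := mulr_ge0 a0 a0; have := mulr_ge0 a0 t0.
  by have := mulr_ge0 i0 t0; have := mulr_ge0 j0 t0; nra.
have N0 : 0 <= N i j.
  have -> : N i j = (a - c) * a * (j%:R - i%:R)
      + t * (a * (a + t + j%:R) + i%:R * (t + j%:R + c)) by rewrite /N; ring.
  have a0 : 0 <= a by lra.
  have aC : 0 <= a - c by lra.
  have ji : 0 <= j%:R - i%:R :> R by lra.
  by rewrite addr_ge0 // ?mulr_ge0 // ?addr_ge0 ?mulr_ge0 ?addr_ge0 // ltW.
rewrite !WE; have := cross _ _ ij; have := mulr_gt0 (p0 j) (q0 i); nra.
Qed.

(** * The Gamma function *)

Definition gamma_integrand {R : realType} (s t : R) : R :=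
  t `^ (s - 1) * expR (- t).

(** The boundary term in the integration by parts that yields the functional
    equation of [Gamma]. *)
Definition gamma_boundary {R : realType} (s t : R) : R := t `^ s * expR (- t).

Lemma gamma_integrand_ge0 (R : realType) (s t : R) : 0 <= gamma_integrand s t.
Proof. by rewrite mulr_ge0 ?powR_ge0 ?expR_ge0. Qed.

Lemma measurable_gamma_integrand (R : realType) (s : R) :
  measurable_fun [set: R] (gamma_integrand s).
Proof.
apply: measurable_funM; first exact: measurable_powR.
by apply: measurableT_comp => //; exact: oppr_measurable.
Qed.

Lemma is_derive_expRN (R : realType) (t : R) :
  is_derive t 1 (fun x : R => expR (- x)) (- expR (- t)).
Proof.
have := @is_derive1_comp R expR -%R t (expR (- t)) (- 1).
by rewrite mulrN1; apply.
Qed.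

Lemma is_derive_gamma_boundary (R : realType) (s t : R) : 0 < t ->
  is_derive t 1 (gamma_boundary s)
    (s * gamma_integrand s t - gamma_integrand (s + 1) t).
Proof.
move=> t0; have D1 := is_derive1_powR s t0.
have D2 := is_derive_expRN t.
have := is_deriveM D1 D2; set df := (X in is_derive _ _ _ X) => D.
suff <- : df = s * gamma_integrand s t - gamma_integrand (s + 1) t by exact: D.
by rewrite /df /gamma_integrand addrK /GRing.scale /=; ring.
Qed.

(** The integrand is itself a boundary term, with [s - 1] for [s], hence
    differentiable. *)
Lemma continuous_gamma_integrand (R : realType) (s t : R) : 0 < t ->
  {for t, continuous (gamma_integrand s)}.
Proof.
move=> t0; apply: differentiable_continuous; apply/derivable1_diffP.
apply: ex_derive; have := @is_derive_gamma_boundary _ (s - 1) _ t0.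
by rewrite /gamma_boundary; apply.
Qed.

(** Stated without subtraction, so that both sides pass to the limit in the
    extended reals before any finiteness is known. *)
Lemma gamma_integral_by_parts (R : realType) (s u v : R) : 0 < u -> u < v ->
  (s%:E * \int[lebesgue_measure]_(t in `[u, v]) (gamma_integrand s t)%:E
     + (gamma_boundary s u)%:E
   = \int[lebesgue_measure]_(t in `[u, v]) (gamma_integrand (s + 1) t)%:E
     + (gamma_boundary s v)%:E)%E.
Proof.
move=> u0 uv.
have pos (t : R) : t \in `[u, v] -> 0 < t.
  by rewrite in_itv /= => /andP[/(lt_le_trans u0)].
have int (r : R) :
    lebesgue_measure.-integrable `[u, v] (EFin \o gamma_integrand r).
  apply: continuous_compact_integrable; first exact: segment_compact.
  apply: continuous_in_subspaceT => t; rewrite inE /= => /pos t0.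
  exact: continuous_gamma_integrand.
have := @continuous_FTC2 R
  (fun t => s * gamma_integrand s t - gamma_integrand (s + 1) t)
  (gamma_boundary s) u v uv.
have D (t : R) : 0 < t -> derivable (gamma_boundary s) t 1.
  by move=> t0; apply: ex_derive; exact: is_derive_gamma_boundary.
have C (t : R) : 0 < t -> gamma_boundary s x @[x --> t] --> gamma_boundary s t.
  by move=> t0; apply/differentiable_continuous/derivable1_diffP/D.
have v0 := lt_trans u0 uv.
have -> //: (\int[lebesgue_measure]_(x in `[u, v])
   (s * gamma_integrand s x - gamma_integrand (s + 1) x)%:E =
   s%:E * \int[lebesgue_measure]_(t in `[u, v]) (gamma_integrand s t)%:E -
   \int[lebesgue_measure]_(t in `[u, v]) (gamma_integrand (s + 1) t)%:E)%E.
  rewrite -integralZl //=; last exact: int.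
  rewrite -integralB_EFin //=.
  by have := integrableZl _ s (int s); apply; exact: measurable_itv.
have fin (r : R) : (\int[lebesgue_measure]_(t in `[u, v])
    (gamma_integrand r t)%:E)%E \is a fin_num.
  by apply: integrable_fin_num => //; exact: int.
rewrite -(fineK (fin s)) -(fineK (fin (s + 1))).
set A := fine _; set B := fine _ => H.
suff : s * A - B = gamma_boundary s v - gamma_boundary s u.
  by move=> E; rewrite -EFinM -!EFinD; congr EFin; lra.
apply: EFin_inj; rewrite EFinB EFinM H //.
- apply: continuous_in_subspaceT => t; rewrite inE /= => /pos t0.
  apply: cvgB; last exact: continuous_gamma_integrand.
  by apply: cvgM; [exact: cvg_cst|exact: continuous_gamma_integrand].
- split.
  + by move=> t /subset_itv_oo_cc /pos; exact: D.
  + by apply: cvg_at_right_filter; exact: C.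
  + by apply: cvg_at_left_filter; exact: C.
- move=> t /subset_itv_oo_cc /pos t0; rewrite derive1E.
  by apply: derive_val; exact: is_derive_gamma_boundary.
Qed.

Lemma gamma_boundary_cvg0 (R : realType) (s : R) : 0 < s ->
  gamma_boundary s n.+2%:R^-1 @[n --> \oo] --> 0.
Proof.
move=> s0; have u0 : (n.+2%:R^-1 : R) @[n --> \oo] --> (0 : R).
  have := @cvg_harmonic R; rewrite -(cvg_shiftS _ (nbhs (0 : R))); exact.
have /cvg_at_rightP/(_ (fun n => n.+2%:R^-1)) H := powR_cvg0 s0.
apply: (squeeze_cvgr (f := cst 0) (h := fun n => n.+2%:R^-1 `^ s)).
- apply: nearW => n; rewrite /gamma_boundary mulr_ge0 ?powR_ge0 ?expR_ge0 //=.
  by rewrite ler_piMr ?powR_ge0 // expR_le1 oppr_le0 invr_ge0.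
- exact: cvg_cst.
- by apply: H; split=> // n; rewrite invr_gt0.
Qed.

(** [t ^ s <= t ^ k] for an integer [k >= s], and
    [exp t >= t ^ (k + 1) / (k + 1)!], so the boundary term is [O (1 / t)]. *)
Lemma gamma_boundary_cvgy (R : realType) (s : R) :
  gamma_boundary s n.+2%:R @[n --> \oo] --> 0.
Proof.
have u0 : (n.+2%:R^-1 : R) @[n --> \oo] --> (0 : R).
  have := @cvg_harmonic R; rewrite -(cvg_shiftS _ (nbhs (0 : R))); exact.
have [k sk] : exists k, s <= k%:R.
  exists (Num.truncn `|s|).+1.
  by rewrite (le_trans (ler_norm s)) // ltW // truncnS_gt.
pose C : R := k.+1`!%:R.
apply: (squeeze_cvgr (f := cst 0) (h := fun n => C * n.+2%:R^-1)).
- apply: nearW => n; rewrite /gamma_boundary mulr_ge0 ?powR_ge0 ?expR_ge0 //=.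
  set t : R := n.+2%:R.
  have t0 : 0 < t by [].
  have tk : t `^ s <= t ^+ k.
    by rewrite -powR_mulrn ?(ltW t0) // ler_powR // /t ler1n.
  have : t ^+ k.+1 / C <= expR t.
    by apply: le_trans (expR_ge1Dxn k (ltW t0)); rewrite lerDr.
  rewrite ler_pdivrMr ?ltr0n ?fact_gt0 // exprSr => et.
  rewrite expRN ler_pdivrMr ?expR_gt0 // mulrAC ler_pdivlMr //.
  by rewrite mulrC [C * _]mulrC (le_trans _ et) // mulrC ler_wpM2r // (ltW t0).
- exact: cvg_cst.
- by rewrite -(mulr0 C); apply: cvgM => //; exact: cvg_cst.
Qed.

Lemma bigcup_itv_exhaust (R : realType) :
  \bigcup_n `[n.+2%:R^-1, n.+2%:R]%classic = `]0, +oo[%classic :> set R.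
Proof.
apply/seteqP; split=> t /=.
  move=> [n _] /=; rewrite !in_itv /= andbT => /andP[+ _].
  by apply: lt_le_trans; rewrite invr_gt0.
rewrite in_itv /= andbT => t0.
exists (Num.truncn (t + t^-1)) => //=; rewrite in_itv /=.
have := truncnS_gt (t + t^-1); set m := Num.truncn _ => mt.
have ti : 0 < t^-1 by rewrite invr_gt0.
have mS : m.+1%:R <= m.+2%:R :> R by rewrite ler_nat.
apply/andP; split; last lra.
by rewrite -[t]invrK lef_pV2 ?posrE //; lra.
Qed.

Lemma gamma_integral_exhaust (R : realType) (s : R) :
  (\int[lebesgue_measure]_(t in `[n.+2%:R^-1%R, n.+2%:R%R])
     (gamma_integrand s t)%:E @[n --> \oo] -->
   \int[lebesgue_measure]_(t in `]0%R, +oo[) (gamma_integrand s t)%:E)%E.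
Proof.
rewrite -bigcup_itv_exhaust; apply: ge0_nondecreasing_set_cvg_integral.
- move=> m n mn; apply/subsetPset => t /=; rewrite !in_itv /= => /andP[mt tm].
  have mnR : m.+2%:R <= n.+2%:R :> R by rewrite ler_nat.
  rewrite (le_trans tm mnR) andbT (le_trans _ mt) // lef_pV2 ?posrE //.
- by move=> i; exact: measurable_itv.
- move=> i; apply/measurable_EFinP; apply: measurable_funTS.
  exact: measurable_gamma_integrand.
- by move=> i t _; rewrite lee_fin gamma_integrand_ge0.
Qed.

(** An identity between possibly infinite integrals, obtained by exhausting
    the half-line by the intervals from [1 / (n + 2)] to [n + 2]; it is also
    what transfers finiteness from [s + 1] to [s]. *)
Lemma gamma_integralS (R : realType) (s : R) : 0 < s ->
  (\int[lebesgue_measure]_(t in `]0%R, +oo[) (gamma_integrand (s + 1) t)%:E =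
   s%:E * \int[lebesgue_measure]_(t in `]0%R, +oo[) (gamma_integrand s t)%:E)%E.
Proof.
move=> s0.
have I_ge0 r (D : set R) :
    (0 <= \int[lebesgue_measure]_(t in D) (gamma_integrand r t)%:E)%E.
  by apply: integral_ge0 => t _; rewrite lee_fin gamma_integrand_ge0.
rewrite -[LHS]adde0 -[RHS]adde0.
pose X n := (\int[lebesgue_measure]_(t in `[n.+2%:R^-1%R, n.+2%:R%R])
  (gamma_integrand (s + 1) t)%:E + (gamma_boundary s n.+2%:R)%:E)%E.
have XE n : X n = (s%:E *
  \int[lebesgue_measure]_(t in `[n.+2%:R^-1%R, n.+2%:R%R])
    (gamma_integrand s t)%:E + (gamma_boundary s n.+2%:R^-1)%:E)%E.
  rewrite /X -gamma_integral_by_parts ?invr_gt0 //.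
  by rewrite (@lt_trans _ _ 1) ?invf_lt1 ?ltr1n.
apply: etrans; last (apply: (@cvg_lim _ _ _ (nbhs \oo) _ X) => //).
  apply/esym/cvg_lim => //; apply: cvgeD.
  - by rewrite ge0_adde_def ?inE.
  - exact: gamma_integral_exhaust.
  - by apply: cvg_EFin; [exact: nearW|exact: gamma_boundary_cvgy].
rewrite (funext XE); apply: cvgeD.
- by rewrite ge0_adde_def ?inE // mule_ge0 ?lee_fin // ltW.
- by apply: cvgeZl => //; exact: gamma_integral_exhaust.
- by apply: cvg_EFin; [exact: nearW|exact: gamma_boundary_cvg0].
Qed.

Lemma gamma_integral1_lty (R : realType) :
  (\int[lebesgue_measure]_(t in `]0%R, +oo[) (gamma_integrand (1 : R) t)%:E
     < +oo)%E.
Proof.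
have E (t : R) : gamma_integrand 1 t = expR (- t).
  by rewrite /gamma_integrand subrr powRr0 mul1r.
have C : continuous (fun t : R => expR (- t)).
  by move=> t; apply: continuous_comp; [exact: cvgN|exact: continuous_expR].
have D (t : R) : is_derive t (1 : R) (fun x => - expR (- x)) (expR (- t)).
  by have := is_deriveN (is_derive_expRN t); rewrite opprK.
apply: (@le_lt_trans _ _
    (\int[lebesgue_measure]_(t in `[0%R, +oo[) (expR (- t : R))%:E)%E).
  under eq_integral do rewrite E.
  apply: ge0_subset_integral => //=.
  - apply/measurable_EFinP/measurable_funTS.
    exact: continuous_measurable_fun.
  - by move=> t /=; rewrite !in_itv /= !andbT; exact: ltW.
rewrite (@ge0_continuous_FTC2y _ _ (fun t => - expR (- t)) _ 0) ?ltry //.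
- by apply: continuous_subspaceT.
- by rewrite -oppr0; apply: cvgN; exact: cvgr_expR.
- by apply: cvg_at_right_filter; apply: cvgN; exact: C.
- by move=> t _; rewrite derive1E; apply: derive_val.
Qed.

(** [t ^ (r - 1)] is monotone in [r], increasing or decreasing according to
    whether [t >= 1] or [t <= 1]. *)
Lemma gamma_integrand_le_sum (R : realType) (u r v t : R) : 0 < t ->
  u <= r <= v ->
  gamma_integrand r t <= gamma_integrand u t + gamma_integrand v t.
Proof.
move=> t0 /andP[ur rv]; rewrite -mulrDl ler_wpM2r ?expR_ge0 //.
have [t1|t1] := leP 1 t.
  by rewrite ler_wpDl ?powR_ge0 // ler_powR // lerD2r.
by rewrite ler_wpDr ?powR_ge0 // ger_powR ?t0 ?lerD2r // ltW.
Qed.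

(** Integers follow from [s = 1] by the functional equation; a real [s >= 1] is
    below some integer, and [gamma_integrand_le_sum] dominates its integrand;
    the functional equation read backwards reaches [0 < s < 1]. *)
Lemma gamma_integral_lty (R : realType) (s : R) : 0 < s ->
  (\int[lebesgue_measure]_(t in `]0%R, +oo[) (gamma_integrand s t)%:E
     < +oo)%E.
Proof.
have nat_lty n : (\int[lebesgue_measure]_(t in `]0%R, +oo[)
    (gamma_integrand (n.+1%:R : R) t)%:E < +oo)%E.
  elim: n => [|n IH]; first exact: gamma_integral1_lty.
  by rewrite -natr1 gamma_integralS // lte_mul_pinfty ?lee_fin.
suff ge1 r : 1 <= r -> (\int[lebesgue_measure]_(t in `]0%R, +oo[)
    (gamma_integrand (r : R) t)%:E < +oo)%E.
  move=> s0; have /ge1 : 1 <= s + 1 by rewrite lerDr ltW.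
  rewrite gamma_integralS //; set I := integral _ _ _; case: I => [r||].
  - by move=> _; exact: ltry.
  - by rewrite gt0_muley ?lte_fin.
  - by [].
move=> r1; have [n rn] : exists n, r <= n.+1%:R.
  by exists (Num.truncn r); rewrite ltW // truncnS_gt.
have := lte_add_pinfty (nat_lty 0%N) (nat_lty n).
apply: le_lt_trans; rewrite -ge0_integralD //=.
- apply: ge0_le_integral => //=.
  + by move=> t _; rewrite lee_fin gamma_integrand_ge0.
  + apply/measurable_EFinP/measurable_funTS; exact: measurable_gamma_integrand.
  + apply: emeasurable_funD;
    by apply/measurable_EFinP/measurable_funTS;
      exact: measurable_gamma_integrand.
  + move=> t; rewrite in_itv /= andbT => t0.
    by rewrite -EFinD lee_fin; apply: gamma_integrand_le_sum; rewrite ?r1.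
- by move=> t _; rewrite lee_fin gamma_integrand_ge0.
- apply/measurable_EFinP/measurable_funTS; exact: measurable_gamma_integrand.
- by move=> t _; rewrite lee_fin gamma_integrand_ge0.
- apply/measurable_EFinP/measurable_funTS; exact: measurable_gamma_integrand.
Qed.

Lemma integrable_gamma_integrand (R : realType) (s : R) : 0 < s ->
  lebesgue_measure.-integrable `]0, +oo[ (EFin \o gamma_integrand s).
Proof.
move=> s0; apply/integrableP; split.
  apply/measurable_EFinP/measurable_funTS; exact: measurable_gamma_integrand.
apply: le_lt_trans (gamma_integral_lty s0).
by under eq_integral do rewrite /= ger0_norm ?gamma_integrand_ge0 //.
Qed.

Lemma GammaE (R : realType) (s : R) :
  Gamma s = \int[lebesgue_measure]_(t in `]0, +oo[) gamma_integrand s t.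
Proof. by []. Qed.

Lemma GammaS (R : realType) (s : R) : 0 < s -> Gamma (s + 1) = s * Gamma s.
Proof.
move=> s0; rewrite !GammaE /Rintegral gamma_integralS // fineM //.
by apply: integrable_fin_num => //; exact: integrable_gamma_integrand.
Qed.

(** For [s >= 1] the integrand is at least [exp (- 2)] between 1 and 2; smaller
    [s] are reached through the functional equation. *)
Lemma Gamma_gt0 (R : realType) (s : R) : 0 < s -> 0 < Gamma s.
Proof.
suff ge1 (r : R) : 1 <= r -> 0 < Gamma r.
  move=> s0; have : 0 < Gamma (s + 1) by apply: ge1; rewrite lerDr ltW.
  by rewrite GammaS // pmulr_rgt0.
move=> r1; have r0 : 0 < r by rewrite (lt_le_trans _ r1).
rewrite GammaE; have int := integrable_gamma_integrand r0.
have sub : (`[1, 2]%classic : set R) `<=` `]0, +oo[%classic.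
  by move=> t /=; rewrite !in_itv /= andbT => /andP[/(lt_le_trans _)-> //].
apply: (@lt_le_trans _ _ (expR (- 2))); first exact: expR_gt0.
rewrite -lee_fin fineK; last exact: integrable_fin_num.
apply: (@le_trans _ _
   (\int[lebesgue_measure]_(t in `[1%R, 2%R]) (gamma_integrand r t)%:E)%E).
  have -> : (expR (- 2) : R)%:E =
      (\int[lebesgue_measure]_(t in `[1%R, 2%R]) (expR (- 2) : R)%:E)%E.
    rewrite integral_cst //= lebesgue_measure_itv /= lte_fin ltr1n -EFinD.
    by rewrite -EFinM; congr EFin; lra.
  apply: ge0_le_integral => //=.
  - apply/measurable_EFinP/measurable_funTS; exact: measurable_gamma_integrand.
  - move=> t; rewrite in_itv /= => /andP[t1 t2].
    rewrite lee_fin /gamma_integrand -[leLHS]mul1r ler_pM ?expR_ge0 //.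
      by have := @ler_powR R t t1 0 (r - 1); rewrite powRr0 subr_ge0; apply.
    by rewrite ler_expR lerN2.
apply: ge0_subset_integral => //=.
- apply/measurable_EFinP/measurable_funTS; exact: measurable_gamma_integrand.
- by move=> t _; rewrite lee_fin gamma_integrand_ge0.
Qed.

(** Near [s] every integrand is dominated by the sum of the integrands at the
    two ends of a compact interval around [s]. *)
Lemma continuous_Gamma (R : realType) (s : R) : 0 < s ->
  {for s, continuous (@Gamma R)}.
Proof.
move=> s0; pose u := s / 2; pose v := s + 1.
have u0 : 0 < u by rewrite divr_gt0.
have us : s \in `]u, v[%classic.
  by rewrite inE /= in_itv /= /u /v; apply/andP; split; lra.
have v0 : 0 < v by rewrite addr_gt0.
apply: (@continuity_under_integral R _ _ lebesgue_measure
  (fun s t => gamma_integrand s t) `]0, +oo[%classic _ u v _ _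
  (fun t => gamma_integrand u t + gamma_integrand v t)) => //.
- move=> r /=; rewrite in_itv /= => /andP[ur _].
  by apply: integrable_gamma_integrand; exact: lt_trans ur.
- apply: aeW => t /=; rewrite in_itv /= andbT => t0 r _.
  rewrite /gamma_integrand; apply: cvgM; last exact: cvg_cst.
  rewrite /powR gt_eqF //.
  apply: (@continuous_comp _ _ _ (fun r : R => (r - 1) * ln t) expR).
    apply: cvgM; last exact: cvg_cst.
    by apply: cvgB => //; exact: cvg_cst.
  exact: continuous_expR.
- have := integrableD _ (integrable_gamma_integrand u0)
    (integrable_gamma_integrand v0).
  by apply; exact: measurable_itv.
- move=> r /=; rewrite in_itv /= => /andP[ur rv].
  apply: aeW => t /=; rewrite in_itv /= andbT => t0.
  rewrite ger0_norm ?gamma_integrand_ge0 //.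
  by apply: gamma_integrand_le_sum; rewrite ?(ltW ur) ?ltW.
Qed.

(** * Power series with nonnegative coefficients *)

Lemma pseriesE (R : realType) (f : nat -> R) (x : R) n :
  pseries f x n = \sum_(k < n) f k * x ^+ k.
Proof. by rewrite /pseries /series /= big_mkord. Qed.

Lemma pseries_nondecreasing (R : realType) (f : nat -> R) (x : R) :
  (forall n, 0 <= f n) -> 0 <= x -> nondecreasing_seq (pseries f x).
Proof.
move=> f0 x0; apply: nondecreasing_series => n _ _.
by rewrite mulr_ge0 ?exprn_ge0.
Qed.

Lemma pseries_le_lim (R : realType) (f : nat -> R) (x : R) n :
  (forall n, 0 <= f n) -> 0 <= x -> cvgn (pseries f x) ->
  pseries f x n <= limn (pseries f x).
Proof.
move=> f0 x0 cf; apply: nondecreasing_cvgn_le => //.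
exact: pseries_nondecreasing.
Qed.

Lemma lim_pseries_ge0 (R : realType) (f : nat -> R) (x : R) :
  (forall n, 0 <= f n) -> 0 <= x -> cvgn (pseries f x) ->
  0 <= limn (pseries f x).
Proof.
move=> f0 x0 cf; apply: le_trans (pseries_le_lim 0 f0 x0 cf).
by rewrite pseriesE big_ord0.
Qed.

Lemma sum_fps_mul (R : realType) (f g : nat -> R) N :
  \sum_(n < N) fps_mul f g n = \sum_(i < N) f i * \sum_(j < N - i) g j.
Proof.
elim: N => [|N IH]; first by rewrite !big_ord0.
rewrite big_ord_recr /= IH /fps_mul [X in _ + X]big_ord_recr /= addrA.
rewrite -big_split /=.
rewrite [RHS]big_ord_recr /= subnn subSnn big_ord1.
rewrite (eq_bigr (fun i : 'I_N => f i * \sum_(j < N.+1 - i) g j)) // => i _.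
by rewrite subSn ?(ltnW (ltn_ord i)) // big_ord_recr /= mulrDr.
Qed.

Lemma fps_mul_scale (R : realType) (f g : nat -> R) (x : R) n :
  fps_mul f g n * x ^+ n =
  fps_mul (fun i => f i * x ^+ i) (fun i => g i * x ^+ i) n.
Proof.
rewrite /fps_mul mulr_suml; apply: eq_bigr => i _.
by rewrite mulrACA -exprD subnKC // -ltnS.
Qed.

(** The triangle [i + j < n] lies between the square [i, j < n / 2] and the
    square [i, j < n], so for nonnegative terms the triangular partial sums are
    squeezed between products of partial sums. *)
Lemma cvg_pseries_fps_mul (R : realType) (f g : nat -> R) (x : R) :
  (forall n, 0 <= f n) -> (forall n, 0 <= g n) -> 0 <= x ->
  cvgn (pseries f x) -> cvgn (pseries g x) ->
  pseries (fps_mul f g) x @ \oo --> limn (pseries f x) * limn (pseries g x).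
Proof.
move=> f0 g0 x0 cf cg.
set F := limn (pseries f x); set G := limn (pseries g x).
pose u i := f i * x ^+ i; pose v i := g i * x ^+ i.
have u0 i : 0 <= u i by rewrite mulr_ge0 ?exprn_ge0.
have v0 i : 0 <= v i by rewrite mulr_ge0 ?exprn_ge0.
have E n : pseries (fps_mul f g) x n = \sum_(i < n) u i * \sum_(j < n - i) v j.
  by rewrite pseriesE -sum_fps_mul; apply: eq_bigr => k _;
    rewrite fps_mul_scale.
have fg0 n : 0 <= fps_mul f g n by apply: sumr_ge0 => i _; rewrite mulr_ge0.
have nd := pseries_nondecreasing fg0 x0.
have leFG n : pseries (fps_mul f g) x n <= F * G.
  apply: (@le_trans _ _ (pseries f x n * pseries g x n)); last first.
    rewrite ler_pM ?pseries_le_lim // pseriesE; apply: sumr_ge0 => i _;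
      rewrite mulr_ge0 ?exprn_ge0 //.
  rewrite E [X in X * _]pseriesE mulr_suml; apply: ler_sum => i _.
  rewrite ler_wpM2l // pseriesE.
  rewrite -(big_mkord xpredT v) -(big_mkord xpredT v).
  by rewrite [leRHS](big_cat_nat (leq0n _) (leq_subr i n)) lerDl sumr_ge0.
have cfg : cvgn (pseries (fps_mul f g) x).
  by apply: nondecreasing_is_cvgn => //; exists (F * G) => _ [n _ <-].
suff -> : F * G = limn (pseries (fps_mul f g) x) by [].
apply/eqP; rewrite eq_le; apply/andP; split; last first.
  by apply: limr_le => //; exact: nearW.
have cFG : (pseries f x n * pseries g x n) @[n --> \oo] --> F * G.
  exact: cvgM.
rewrite -(cvg_lim _ cFG) //; apply: limr_le; first exact: cvgP cFG.
apply: nearW => n.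
apply: le_trans (pseries_le_lim (n + n) fg0 x0 cfg).
rewrite E big_split_ord /= -[leLHS]addr0 lerD //; last first.
  by apply: sumr_ge0 => i _; rewrite mulr_ge0 ?sumr_ge0.
rewrite pseriesE mulr_suml; apply: ler_sum => i _.
apply: ler_wpM2l; first exact: u0.
rewrite pseriesE -(big_mkord xpredT v) -(big_mkord xpredT v).
have ni : (n <= n + n - i)%N by rewrite -addnBA ?leq_addr // ltnW.
by rewrite [leRHS](big_cat_nat (leq0n _) ni) lerDl sumr_ge0.
Qed.

(** [(y ^ (n + 1) - x ^ (n + 1)) / (y - x)] is a sum of [n + 1] monomials, each
    of them at least [x ^ n]. *)
Lemma derivative_monomial_le (R : realType) (x y : R) n :
  0 <= x -> x < y -> n.+1%:R * x ^+ n <= y ^+ n.+1 / (y - x).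
Proof.
move=> x0 xy; rewrite ler_pdivlMr ?subr_gt0 //.
apply: (@le_trans _ _ (y ^+ n.+1 - x ^+ n.+1)); last first.
  by rewrite lerBlDr lerDl exprn_ge0.
rewrite subrXX mulrC ler_pM2l ?subr_gt0 // mulr_natl.
rewrite -[X in x ^+ n *+ X](card_ord n.+1) -sumr_const ler_sum // => i _.
have iN : (i <= n)%N by rewrite -ltnS.
rewrite /= -[X in x ^+ X <= _](subnK iN) exprD ler_wpM2r ?exprn_ge0 //.
by rewrite lerXn2r ?nnegrE ?(ltW xy) // (le_trans x0) // ltW.
Qed.

(** The terms of the derived series at [x] are bounded by those of the original
    series at [y], up to the factor [1 / (y - x)]. *)
Lemma is_cvg_pseries_diffs (R : realType) (f : nat -> R) (x y : R) :
  (forall n, 0 <= f n) -> 0 <= x -> x < y ->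
  cvgn (pseries f y) -> cvgn (pseries (pseries_diffs f) x).
Proof.
move=> f0 x0 xy cf; have y0 : 0 < y := le_lt_trans x0 xy.
have d0 n : 0 <= pseries_diffs f n by rewrite mulr_ge0.
apply: nondecreasing_is_cvgn; first exact: pseries_nondecreasing.
exists (limn (pseries f y) / (y - x)) => _ [n _ <-].
apply: (@le_trans _ _ (pseries f y n.+1 / (y - x))); last first.
  by rewrite ler_pM2r ?invr_gt0 ?subr_gt0 // pseries_le_lim // ltW.
rewrite !pseriesE big_ord_recl mulrDl ler_wpDl //.
  by rewrite mulr_ge0 ?mulr_ge0 ?invr_ge0 ?subr_ge0 ?(ltW xy) //
    exprn_ge0 // ltW.
rewrite mulr_suml ler_sum // => i _.
rewrite /pseries_diffs mulrAC mulrC -mulrA ler_wpM2l //.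
exact: derivative_monomial_le.
Qed.

Lemma iter_pseries_diffs_ge0 (R : realType) (f : nat -> R) k :
  (forall n, 0 <= f n) -> forall n, 0 <= iter k (@pseries_diffs R) f n.
Proof. by move=> f0; elim: k => //= k IH n; rewrite mulr_ge0. Qed.

Lemma is_cvg_iter_pseries_diffs (R : realType) (f : nat -> R) (x y : R) k :
  (forall n, 0 <= f n) -> 0 <= x -> x < y ->
  cvgn (pseries f y) -> cvgn (pseries (iter k (@pseries_diffs R) f) x).
Proof.
move=> f0; elim: k x => [|k IH] x x0 xy cf /=.
  by apply: is_cvg_pseries_inside cf _;
    rewrite !ger0_norm // (le_trans x0) // ltW.
have [xm my] := midf_lt xy; set m := _ / _ in xm my.
apply: (is_cvg_pseries_diffs (y := m)) => //.
  exact: iter_pseries_diffs_ge0.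
by apply: IH => //; rewrite (le_trans x0) // ltW.
Qed.

(** Convergence and value together: a limit of a divergent sequence is a junk
    value. *)
Definition sum_of_power_series_on {R : realType} (L : nat -> R) (D : set R)
    (f : R -> R) : Prop :=
  forall x, D x -> cvgn (pseries L x) /\ f x = limn (pseries L x).

(** Every interior point of [D] lies below a larger point of [D], so the series
    may be differentiated termwise there, any number of times. *)
Lemma absolutely_monotonic_power_series (R : realType) (L : nat -> R)
    (D : set R) (f : R -> R) :
  (forall n, 0 <= L n) -> (forall x, D x -> 0 < x) ->
  sum_of_power_series_on L D f -> absolutely_monotonic_on D f.
Proof.
move=> L0 D0 fE; split=> [x Dx|].
  by have [cL ->] := fE _ Dx; rewrite lim_pseries_ge0 // ltW // D0.
have larger x : interior D x -> 0 < x /\ exists2 y, x < y & D y.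
  move=> Dx; split; first exact: D0 (interior_subset Dx).
  have /nbhs_ballP[e /= e0 eD] := Dx.
  exists (x + e / 2); first by rewrite ltrDl divr_gt0.
  apply: eD; rewrite /ball /= opprD addrA subrr add0r normrN.
  rewrite gtr0_norm ?divr_gt0 //.
  by rewrite ltr_pdivrMr // ltr_pMr // ltr1n.
have cvgD k x : interior D x -> cvgn (pseries (iter k (@pseries_diffs R) L) x).
  move=> /larger[x0 [y xy Dy]]; have [cL _] := fE _ Dy.
  exact: is_cvg_iter_pseries_diffs (ltW x0) xy cL.
have step k x : interior D x -> is_derive x 1
    (fun x => limn (pseries (iter k (@pseries_diffs R) L) x))
    (limn (pseries (iter k.+1 (@pseries_diffs R) L) x)).
  move=> /larger[x0 [y xy Dy]]; have [cL _] := fE _ Dy.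
  have [xm my] := midf_lt xy; set m := _ / _ in xm my.
  have m0 := lt_trans x0 xm.
  have c j := is_cvg_iter_pseries_diffs (k := j) L0 (ltW m0) my cL.
  apply: (pseries_snd_diffs (c k) (c k.+1) (c k.+2)).
  by rewrite !gtr0_norm.
have nearD (P : R -> Prop) x : interior D x ->
    (forall z, interior D z -> P z) -> \forall z \near x, P z.
  by move=> Dx DP; exact: filterS DP (nbhs_interior Dx).
have E k x : interior D x ->
    derive1n k f x = limn (pseries (iter k (@pseries_diffs R) L) x).
  elim: k x => [|k IH] x Dx.
    by rewrite derive1n0; have [_ ->] := fE _ (interior_subset Dx).
  rewrite derive1nS derive1E; have [_ <-] := step k x Dx.
  by apply: near_eq_derive; exact: nearD.
move=> k x Dx; split; last first.
  rewrite E //; apply: lim_pseries_ge0; last exact: cvgD.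
    exact: iter_pseries_diffs_ge0.
  exact: ltW (D0 _ (interior_subset Dx)).
have [D1 _] := step k x Dx; apply: (near_eq_derivable _ D1).
by apply: nearD => // z Dz; rewrite E.
Qed.

Lemma weighted_AM_GM (R : realType) (u v t : R) : 0 <= u -> 0 <= v ->
  0 <= t <= 1 -> u `^ t * v `^ (1 - t) <= t * u + (1 - t) * v.
Proof.
move=> u0 v0 /andP[]; rewrite le_eqVlt => /predU1P[<- _|t0].
  by rewrite subr0 powRr0 powRr1 // !mul1r mul0r add0r.
rewrite le_eqVlt => /predU1P[->|t1].
  by rewrite subrr powRr0 powRr1 // mulr1 mul1r mul0r addr0.
have t1' : 0 < 1 - t by rewrite subr_gt0.
have := @conjugate_powR R (u `^ t) (v `^ (1 - t)) t^-1 (1 - t)^-1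
  (powR_ge0 _ _) (powR_ge0 _ _).
rewrite !invr_gt0 !invrK subrKC => /(_ t0 t1' erefl).
rewrite -!powRrM !divff ?gt_eqF // !powRr1 //.
by rewrite (mulrC u) (mulrC v).
Qed.

Lemma powR_convex_split (R : realType) (x t : R) : 0 <= x ->
  x `^ t * x `^ (1 - t) = x.
Proof. by move=> x0; rewrite -powRD subrKC ?powRr1 // oner_eq0. Qed.

Lemma powR_exprn (R : realType) (x t : R) k : 0 <= x ->
  (x ^+ k) `^ t = (x `^ t) ^+ k.
Proof. by move=> x0; rewrite -!powR_mulrn ?powR_ge0 // powRAC. Qed.

(** Hoelder's inequality for the sums of [L k * x ^ k] and [L k * y ^ k] with
    exponents [1 / t] and [1 / (1 - t)]: with [z = x ^ t * y ^ (1 - t)], the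
    term [L k * z ^ k] is the corresponding weighted geometric mean.  It is
    proved by normalizing both sums to 1 and applying the arithmetic-geometric mean
    inequality termwise; the same inequality puts [z] below [max x y], hence
    in [D]. *)
Lemma multiplicatively_convex_power_series (R : realType) (L : nat -> R)
    (D : set R) (f : R -> R) :
  (forall n, 0 <= L n) -> (forall x, D x -> 0 < x) ->
  (forall x y, 0 < x <= y -> D y -> D x) ->
  sum_of_power_series_on L D f -> multiplicatively_convex_on D f.
Proof.
move=> L0 D0 Ddown fE.
have f0 x : D x -> 0 <= f x.
  by move=> Dx; have [cL ->] := fE _ Dx; rewrite lim_pseries_ge0 // ltW // D0.
split=> // x y t Dx Dy t01; have [t0 t1] := andP t01.
have x0 := D0 _ Dx; have y0 := D0 _ Dy.
set z := x `^ t * y `^ (1 - t).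
have z0 : 0 < z by rewrite mulr_gt0 ?powR_gt0.
have Dz : D z.
  have := weighted_AM_GM (ltW x0) (ltW y0) t01; rewrite -/z => zxy.
  by have [xy|yx] := leP x y; [apply: Ddown Dy|apply: Ddown Dx];
    rewrite z0 /=; nra.
have [cz ->] := fE _ Dz.
have term_le n w : D w -> L n * w ^+ n <= f w.
  move=> Dw; have w0 := ltW (D0 _ Dw).
  have [cw ->] := fE _ Dw; apply: le_trans (pseries_le_lim n.+1 L0 w0 cw).
  rewrite pseriesE big_ord_recr /= lerDr sumr_ge0 // => i _.
  by rewrite mulr_ge0 ?exprn_ge0.
apply: limr_le => //; apply: nearW => N; rewrite pseriesE.
(* If [f] vanishes at one point of [D], then all coefficients vanish. *)
have zero w : D w -> f w = 0 -> \sum_(k < N) L k * z ^+ k <= 0.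
  move=> Dw fw0; rewrite big1 // => k _.
  have := term_le k w Dw; rewrite fw0 pmulr_lle0 ?exprn_gt0 ?D0 // => Lk.
  by have -> : L k = 0 by [apply/eqP; rewrite eq_le Lk L0]; rewrite mul0r.
have RHS0 : 0 <= f x `^ t * f y `^ (1 - t) by rewrite mulr_ge0 ?powR_ge0.
have [fx0|fx0] := eqVneq (f x) 0; first exact: le_trans (zero _ Dx fx0) RHS0.
have [fy0|fy0] := eqVneq (f y) 0; first exact: le_trans (zero _ Dy fy0) RHS0.
have {}fx0 : 0 < f x by rewrite lt_neqAle eq_sym fx0 f0.
have {}fy0 : 0 < f y by rewrite lt_neqAle eq_sym fy0 f0.
have partial_le w : D w -> \sum_(k < N) L k * w ^+ k <= f w.
  move=> Dw; have [cw ->] := fE _ Dw.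
  by rewrite -pseriesE pseries_le_lim // ltW // D0.
pose u k := L k * x ^+ k / f x; pose v k := L k * y ^+ k / f y.
have u0 k : 0 <= u k by rewrite divr_ge0 ?mulr_ge0 ?exprn_ge0 // ltW.
have v0 k : 0 <= v k by rewrite divr_ge0 ?mulr_ge0 ?exprn_ge0 // ltW.
have E k : L k * z ^+ k =
    f x `^ t * f y `^ (1 - t) * (u k `^ t * v k `^ (1 - t)).
  rewrite mulrACA -!powRM ?(ltW fx0) ?(ltW fy0) //.
  have -> : f x * u k = L k * x ^+ k by rewrite mulrC divfK // gt_eqF.
  have -> : f y * v k = L k * y ^+ k by rewrite mulrC divfK // gt_eqF.
  have x0' := ltW x0; have y0' := ltW y0.
  rewrite !powRM ?exprn_ge0 // mulrACA powR_convex_split //; congr (_ * _).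
  by rewrite /z exprMn !powR_exprn.
under eq_bigr do rewrite E.
rewrite -mulr_sumr ler_piMr //.
apply: (@le_trans _ _ (\sum_(k < N) (t * u k + (1 - t) * v k))).
  by apply: ler_sum => k _; exact: weighted_AM_GM.
rewrite big_split /= -!mulr_sumr -!mulr_suml.
have ux : (\sum_(i < N) L i * x ^+ i) / f x <= 1.
  by rewrite ler_pdivrMr // mul1r partial_le.
have vy : (\sum_(i < N) L i * y ^+ i) / f y <= 1.
  by rewrite ler_pdivrMr // mul1r partial_le.
have t1' : 0 <= 1 - t by rewrite subr_ge0.
by have := ler_wpM2l t0 ux; have := ler_wpM2l t1' vy; lra.
Qed.

(** * Coefficientwise inequalities for the family *)

Definition fact_coef {R : realType} (h : nat -> R) (n : nat) : R :=
  h n / n`!%:R.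

Lemma fact_coef_ge0 (R : realType) (h : nat -> R) :
  (forall n, 0 <= h n) -> forall n, 0 <= fact_coef h n.
Proof. by move=> h0 n; rewrite divr_ge0. Qed.

(** Multiplying [h n / n!] by [n] leaves [h n / (n - 1)!]; the factorials on the
    two sides then agree. *)
Lemma fact_coef_cross (R : realType) (h : nat -> R) :
  nonincreasing_ratios h ->
  forall i j, (i <= j)%N ->
  j%:R * (pred_coef (fact_coef h) i * fact_coef h j) <=
  i%:R * (fact_coef h i * pred_coef (fact_coef h) j).
Proof.
move=> cross [|i] [|j] //= ij; first by rewrite !mul0r.
  by rewrite !mul0r mulr0.
have E n : n.+1%:R * fact_coef h n.+1 = h n.+1 / n`!%:R.
  by rewrite /fact_coef factS natrM invfM mulrCA mulVKf ?pnatr_eq0.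
rewrite mulrCA E mulrA E /fact_coef mulrACA [leRHS]mulrACA.
by rewrite ler_wpM2r ?mulr_ge0 ?invr_ge0 // cross.
Qed.

Lemma fact_coef_cross_weak (R : realType) (h : nat -> R) :
  (forall n, 0 <= h n) ->
  nonincreasing_ratios h ->
  forall i j, (i <= j)%N ->
  pred_coef (fact_coef h) i * fact_coef h j <=
  fact_coef h i * pred_coef (fact_coef h) j.
Proof.
move=> h0 cross i [|j] ij; first by case: i ij => // _; rewrite /= mul0r mulr0.
have j0 : 0 < j.+1%:R :> R by [].
rewrite -(ler_pM2l j0); apply: le_trans (fact_coef_cross cross ij) _.
by rewrite /= ler_wpM2r ?ler_nat // mulr_ge0 ?fact_coef_ge0.
Qed.

Definition gamma_ratio {R : realType} (a c : R) (n : nat) : R :=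
  rising a n / Gamma (c + n%:R).

Lemma rising_gt0 (R : realType) (a : R) n : 0 < a -> 0 < rising a n.
Proof. by move=> a0; apply: prodr_gt0 => i _; rewrite ltr_wpDr. Qed.

Lemma ratio_sequence_gamma_ratio (R : realType) (a c : R) :
  0 < a -> 0 < c -> ratio_sequence a c (gamma_ratio a c).
Proof.
move=> a0 c0; have ck k : 0 < c + k%:R by rewrite ltr_wpDr.
split=> k; first by rewrite divr_gt0 ?rising_gt0 ?Gamma_gt0.
rewrite /gamma_ratio -natr1 addrA GammaS // /rising big_ord_recr /=.
by field; rewrite !gt_eqF // Gamma_gt0.
Qed.

Lemma gamma_ratio_shift (R : realType) (a c : R) n : 0 < a ->
  gamma_ratio (a + 1) (c + 1) n = gamma_ratio a c n.+1 / a.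
Proof.
move=> a0; rewrite /gamma_ratio -natr1 addrA addrAC.
rewrite [rising a n.+1]/rising big_ord_recl /= addr0.
rewrite [X in a * X](_ : _ = rising (a + 1) n); last first.
  by apply: eq_bigr => i _; rewrite -addrA nat1r.
by rewrite mulrAC [a * _]mulrC mulfK // gt_eqF.
Qed.

Lemma hcoefE (R : realType) (a c : R) (h : nat -> R) mu n :
  hcoef a c h mu n = fact_coef h n * gamma_ratio (a + mu) (c + mu) n.
Proof. by rewrite /hcoef /fact_coef mulrAC. Qed.

(** Raising [mu] by 1 raises the index of [gamma_ratio] by 1 and divides by
    [a + mu], so the difference of the two sides, multiplied by
    [(a + mu) * (a + mu + t)], is the sum estimated in the three
    [unit_shift_coef_ge0] lemmas, with [a + mu] and [c + mu] for [a] and [c].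
    The difference [a - c], hence the case distinction, does not depend
    on [mu]. *)
Lemma hcoef_unit_shift_le (R : realType) (a c : R) (h : nat -> R) mu t n :
  0 < a -> 0 < c -> (forall n, 0 <= h n) ->
  c <= a <= c + 1 \/ nonincreasing_ratios h ->
  0 <= mu -> 0 <= t ->
  fps_mul (hcoef a c h mu) (hcoef a c h (mu + 1 + t)) n <=
  fps_mul (hcoef a c h (mu + 1)) (hcoef a c h (mu + t)) n.
Proof.
move=> a0 c0 h0 H mu0 t0.
set A := a + mu; set C := c + mu.
have A0 : 0 < A by rewrite ltr_wpDr.
have C0 : 0 < C by rewrite ltr_wpDr.
have At0 : 0 < A + t by rewrite ltr_wpDr.
have Ct0 : 0 < C + t by rewrite ltr_wpDr.
pose P := gamma_ratio A C; pose Q := gamma_ratio (A + t) (C + t).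
have rP : ratio_sequence A C P by exact: ratio_sequence_gamma_ratio.
have rQ : ratio_sequence (A + t) (C + t) Q by exact: ratio_sequence_gamma_ratio.
pose g := fact_coef h.
have key : 0 <= \sum_(k < n.+1) g k * g (n - k)%N *
    ((A + t) * (P k.+1 * Q (n - k)%N) - A * (P k * Q (n - k).+1)).
  case: H => [ac|cross].
    apply: unit_shift_coef_ge0_middle rP rQ (fact_coef_ge0 h0) => //.
    by rewrite /A /C; lra.
  have [ca|ac] := leP C A.
    apply: unit_shift_coef_ge0_large rP rQ (fact_coef_ge0 h0) _ => //.
    exact: fact_coef_cross_weak.
  apply: unit_shift_coef_ge0_small rP rQ (fact_coef_ge0 h0) _ => //.
    exact: ltW.
  exact: fact_coef_cross.
rewrite -subr_ge0 -(pmulr_rge0 _ (mulr_gt0 A0 At0)) /fps_mul -sumrB mulr_sumr.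
congr (is_true (0 <= _)): key; apply: eq_bigr => k _.
rewrite !hcoefE !addrA -/A -/C ![_ + 1 + t]addrAC !gamma_ratio_shift //.
rewrite -/P -/Q -/g; set q := Q _; set q' := Q _; set p := P _; set p' := P _.
field; by rewrite !gt_eqF.
Qed.

Lemma hcoef_ge0 (R : realType) (a c : R) (h : nat -> R) mu n :
  0 < a -> 0 < c -> (forall n, 0 <= h n) -> 0 <= mu -> 0 <= hcoef a c h mu n.
Proof.
move=> a0 c0 h0 mu0; rewrite hcoefE mulr_ge0 ?fact_coef_ge0 // ltW //.
by have [] := @ratio_sequence_gamma_ratio R (a + mu) (c + mu);
  rewrite ?ltr_wpDr.
Qed.

(** A shift by [m] is a chain of unit shifts: from the pair of parameters
    [(mu, mu + m + t)] to [(mu + 1, mu + m + t - 1)], and so on down to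
    [(mu + m, mu + t)].  The gap left at the last step is [t - m + 1], hence
    the bound on [t]. *)
Lemma hcoef_shift_le (R : realType) (a c : R) (h : nat -> R) :
  0 < a -> 0 < c -> (forall n, 0 <= h n) ->
  c <= a <= c + 1 \/ nonincreasing_ratios h ->
  forall (m : nat) (t mu : R) n, m%:R - 1 <= t -> 0 <= mu ->
  fps_mul (hcoef a c h mu) (hcoef a c h (mu + m%:R + t)) n <=
  fps_mul (hcoef a c h (mu + m%:R)) (hcoef a c h (mu + t)) n.
Proof.
move=> a0 c0 h0 H; elim=> [|m IH] t mu n mt mu0; first by rewrite !addr0.
have mR : 0 <= m%:R :> R by [].
move: mt; rewrite -natr1 => mt.
have := @hcoef_unit_shift_le R a c h mu (m%:R + t) n a0 c0 h0 H mu0.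
have := IH (t - 1) (mu + 1) n.
have -> : mu + 1 + (m%:R + t) = mu + (m%:R + 1) + t by ring.
have -> : mu + 1 + m%:R + (t - 1) = mu + (m%:R + t) by ring.
have -> : mu + 1 + m%:R = mu + (m%:R + 1) by ring.
have -> : mu + 1 + (t - 1) = mu + t by ring.
have h1 : m%:R - 1 <= t - 1 by lra.
have h2 : 0 <= mu + 1 by lra.
have h3 : 0 <= m%:R + t by lra.
by move=> /(_ h1 h2) A /(_ h3) B; exact: le_trans B A.
Qed.

Lemma continuous_hcoef (R : realType) (a c : R) (h : nat -> R) n :
  0 < c -> {within `[0, +oo[, continuous (fun mu => hcoef a c h mu n)}.
Proof.
move=> c0; apply: continuous_in_subspaceT => mu.
rewrite inE /= in_itv /= andbT => mu0.
have cn : 0 < c + mu + n%:R by rewrite ltr_wpDr // ltr_wpDr.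
have shift (u v : R) : {for mu, continuous (fun mu => u + mu + v)}.
  by apply: cvgD; [apply: cvgD => //; exact: cvg_cst|exact: cvg_cst].
have risingC m : {for mu, continuous (fun mu => rising (a + mu) m)}.
  elim: m => [|m IH].
    have -> : (fun mu => rising (a + mu) 0) = cst 1.
      by apply/funext => x; rewrite /rising big_ord0.
    exact: cvg_cst.
  have -> : (fun mu => rising (a + mu) m.+1) =
            (fun mu => rising (a + mu) m * (a + mu + m%:R)).
    by apply/funext => x; rewrite /rising big_ord_recr.
  by apply: cvgM => //; exact: shift.
apply: cvgM; last exact: cvg_cst.
apply: cvgM; first exact: cvg_cst.
apply: cvgM; first exact: risingC.
apply: cvgV; first by rewrite gt_eqF // Gamma_gt0.
apply: (@continuous_comp _ _ _ (fun mu => c + mu + n%:R) (@Gamma R)).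
  exact: shift.
exact: continuous_Gamma.
Qed.

(** * Values of the series *)

Lemma fps_mulC (R : realType) (f g : nat -> R) : fps_mul f g = fps_mul g f.
Proof.
apply/funext => n; rewrite /fps_mul (reindex_inj rev_ord_inj) /=.
apply: eq_bigr => k _; rewrite mulrC subSS subKn //.
by rewrite -ltnS.
Qed.

Lemma lim_pseries_mul_le (R : realType) (f1 f2 g1 g2 : nat -> R) (x : R) :
  0 <= x -> (forall n, 0 <= f1 n) -> (forall n, 0 <= f2 n) ->
  (forall n, 0 <= g1 n) -> (forall n, 0 <= g2 n) ->
  cvgn (pseries f1 x) -> cvgn (pseries f2 x) ->
  cvgn (pseries g1 x) -> cvgn (pseries g2 x) ->
  (forall n, fps_mul f1 f2 n <= fps_mul g1 g2 n) ->
  limn (pseries f1 x) * limn (pseries f2 x) <=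
  limn (pseries g1 x) * limn (pseries g2 x).
Proof.
move=> x0 f10 f20 g10 g20 cf1 cf2 cg1 cg2 le.
have F := cvg_pseries_fps_mul f10 f20 x0 cf1 cf2.
have G := cvg_pseries_fps_mul g10 g20 x0 cg1 cg2.
rewrite -(cvg_lim _ F) // -(cvg_lim _ G) //.
apply: ler_lim; [exact: cvgP F|exact: cvgP G|apply: nearW => n].
by rewrite !pseriesE ler_sum // => i _; rewrite ler_wpM2r ?exprn_ge0.
Qed.

(** The unit step says that [mu |-> F (mu + 1) / F mu] is nonincreasing along
    every shift [t >= 0]; [F (mu + m) / F mu] is a product of such quotients.
    Unlike the coefficientwise chain, this needs no lower bound on [t], but it
    divides by values of [F]. *)
Lemma unit_steps_Wright (R : realType) (F : R -> R) :
  (forall mu, 0 <= mu -> 0 < F mu) ->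
  (forall mu t, 0 <= mu -> 0 <= t ->
     F mu * F (mu + 1 + t) <= F (mu + 1) * F (mu + t)) ->
  discrete_Wright_log_concave F.
Proof.
move=> F0 step; split=> [mu mu0|m mu t _ mu0 t0]; first exact/ltW/F0.
elim: m => [|m IH]; first by rewrite !addr0.
have mR : 0 <= m%:R :> R by [].
have m0 : 0 <= mu + m%:R by lra.
have st := step _ _ m0 t0; rewrite -natr1.
have -> : mu + (m%:R + 1) = mu + m%:R + 1 by ring.
have p1 : 0 < F (mu + m%:R) by exact: F0.
have p2 : 0 < F (mu + m%:R + t) by apply: F0; lra.
have p3 : 0 < F mu by exact: F0.
have p4 : 0 < F (mu + m%:R + 1 + t) by apply: F0; lra.
rewrite -(ler_pM2r (mulr_gt0 p1 p2)).
have := ler_pM (ltW (mulr_gt0 p1 p4)) (ltW (mulr_gt0 p3 p2)) st IH.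
by congr (is_true (_ <= _)); ring.
Qed.

(** If [h] vanishes identically, so does the function and there is nothing to
    divide by; otherwise one positive coefficient makes it positive. *)
Lemma hfun_Wright (R : realType) (a c x : R) (h : nat -> R) :
  0 < a -> 0 < c -> (forall n, 0 <= h n) ->
  c <= a <= c + 1 \/ nonincreasing_ratios h ->
  0 < x -> (forall mu : R, 0 <= mu -> cvgn (pseries (hcoef a c h mu) x)) ->
  discrete_Wright_log_concave (fun mu => hfun a c h mu x).
Proof.
move=> a0 c0 h0 H x0 cvh; have x0' := ltW x0.
have hc mu n : 0 <= mu -> 0 <= hcoef a c h mu n by exact: hcoef_ge0.
have [[N hN]|hz] := pselect (exists n, h n != 0); last first.
  have hz0 mu : hfun a c h mu x = 0.
    rewrite /hfun (_ : pseries _ _ = cst 0) ?lim_cst //.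
    apply/funext => n; rewrite pseriesE big1 // => k _.
    have -> : hcoef a c h mu k = 0; last by rewrite mul0r.
    rewrite /hcoef; have -> : h k = 0; last by rewrite !mul0r.
    by apply/eqP/negPn/negP => hk; apply: hz; exists k.
  by split=> [mu _|m mu t _ _ _]; rewrite !hz0 ?mul0r.
apply: unit_steps_Wright => [mu mu0|mu t mu0 t0].
  have := pseries_le_lim N.+1 (fun n => hc mu n mu0) x0' (cvh _ mu0).
  apply: lt_le_trans; rewrite pseriesE big_ord_recr /= ltr_wpDl //.
    by rewrite sumr_ge0 // => i _; rewrite mulr_ge0 ?exprn_ge0 ?hc.
  rewrite mulr_gt0 ?exprn_gt0 // lt_neqAle eq_sym hc // andbT hcoefE.
  have [P0 _] : ratio_sequence (a + mu) (c + mu)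
      (gamma_ratio (a + mu) (c + mu)).
    by apply: ratio_sequence_gamma_ratio; rewrite ltr_wpDr.
  by rewrite mulf_neq0 ?(gt_eqF (P0 _)) // mulf_neq0 // invr_neq0 //
    pnatr_eq0 -lt0n fact_gt0.
have m1 : 0 <= mu + 1 by lra.
have mt : 0 <= mu + t by lra.
have m1t : 0 <= mu + 1 + t by lra.
apply: (lim_pseries_mul_le x0' (hc mu ^~ mu0) (hc _ ^~ m1t) (hc _ ^~ m1)
  (hc _ ^~ mt) (cvh _ mu0) (cvh _ m1t) (cvh _ m1) (cvh _ mt)) => n.
exact: hcoef_unit_shift_le.
Qed.

Lemma lambda_fun_power_series (R : realType) (a c mu nu : R) (h : nat -> R) :
  0 < a -> 0 < c -> (forall n, 0 <= h n) -> 0 <= mu -> 0 <= nu ->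
  sum_of_power_series_on (lambda_coef a c h mu nu) (lambda_dom a c h mu nu)
    (lambda_fun a c h mu nu).
Proof.
move=> a0 c0 h0 mu0 nu0 x [x0 cv]; have x0' := ltW x0.
have hc s n : 0 <= s -> 0 <= hcoef a c h s n by exact: hcoef_ge0.
have mn0 : 0 <= mu + nu by rewrite addr_ge0.
have cmu : cvgn (pseries (hcoef a c h mu) x) by apply: cv; rewrite !inE eqxx.
have cnu : cvgn (pseries (hcoef a c h nu) x).
  by apply: cv; rewrite !inE eqxx orbT.
have cz : cvgn (pseries (hcoef a c h 0) x).
  by apply: cv; rewrite !inE eqxx !orbT.
have cs : cvgn (pseries (hcoef a c h (mu + nu)) x).
  by apply: cv; rewrite !inE eqxx !orbT.
have F := cvg_pseries_fps_mul (fun n => hc _ n mu0) (fun n => hc _ n nu0)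
  x0' cmu cnu.
have G := cvg_pseries_fps_mul (fun n => hc _ n (lexx 0)) (fun n => hc _ n mn0)
  x0' cz cs.
pose f := fps_mul (hcoef a c h mu) (hcoef a c h nu).
pose g := fps_mul (hcoef a c h 0) (hcoef a c h (mu + nu)).
have E n :
    pseries (lambda_coef a c h mu nu) x n = pseries f x n - pseries g x n.
  rewrite /pseries /series /= -sumrB.
  by apply: eq_bigr => k _; rewrite -mulrBl.
have L : pseries (lambda_coef a c h mu nu) x @ \oo --> lambda_fun a c h mu nu x.
  rewrite (funext E) /lambda_fun /hfun.
  exact: cvgB F G.
by split; [exact: cvgP L|rewrite (cvg_lim _ L)].
Qed.

Lemma lambda_dom_downward (R : realType) (a c mu nu x y : R) (h : nat -> R) :
  0 < x <= y -> lambda_dom a c h mu nu y -> lambda_dom a c h mu nu x.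
Proof.
move=> /andP[x0 xy] [y0 cv]; split=> // s /cv cvy.
move: xy; rewrite le_eqVlt => /predU1P[->//|xy].
by apply: is_cvg_pseries_inside cvy _; rewrite !gtr0_norm.
Qed.

Theorem theorem5 (R : realType) (a c : R) (h : nat -> R)
  (Hac : (0 < c /\ c <= a <= c + 1 /\ (forall n, 0 <= h n)) \/
         (0 < c /\ (0 < a < c \/ c + 1 < a) /\
          log_concave h /\ no_internal_zeros h)) :
  (forall x : R, 0 < x ->
     (forall mu : R, 0 <= mu -> cvgn (pseries (hcoef a c h mu) x)) ->
     discrete_Wright_log_concave (fun mu => hfun a c h mu x)) /\
  discrete_q_log_concave (hcoef a c h) /\
  (forall (nu : nat) (mu : R), (0 < nu)%N -> nu%:R - 1 <= mu ->
     (forall n, 0 <= lambda_coef a c h mu nu%:R n) /\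
     absolutely_monotonic_on (lambda_dom a c h mu nu%:R)
       (lambda_fun a c h mu nu%:R) /\
     multiplicatively_convex_on (lambda_dom a c h mu nu%:R)
       (lambda_fun a c h mu nu%:R)).
Proof.
have [c0 [a0 [h0 H]]] : 0 < c /\ 0 < a /\ (forall n, 0 <= h n) /\
    (c <= a <= c + 1 \/ nonincreasing_ratios h).
  case: Hac => [[c0 [ac h0]]|[c0 [ac [hlc hz]]]].
    by split=> //; split; [lra|split=> //; left].
  split=> //; split; first by case: ac; lra.
  by split; [case: hlc|right; exact: log_concave_nonincreasing_ratios].
split; first by move=> x x0 cv; exact: hfun_Wright.
split.
  split=> [n mu mu0|n|m t mu _ mt mu0 n].
  - exact: hcoef_ge0.
  - exact: continuous_hcoef.
  - by rewrite subr_ge0; exact: hcoef_shift_le.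
move=> nu mu nu0 numu.
have nuR : 1 <= nu%:R :> R by rewrite ler1n.
have mu0 : 0 <= mu by lra.
(* [nu] plays the shift, [mu] the gap, and the base point is 0. *)
have L0 n : 0 <= lambda_coef a c h mu nu%:R n.
  rewrite subr_ge0 (fps_mulC (hcoef a c h mu)).
  have := @hcoef_shift_le R a c h a0 c0 h0 H nu mu 0 n numu (lexx 0).
  by rewrite !add0r [nu%:R + mu]addrC.
have S : sum_of_power_series_on (lambda_coef a c h mu nu%:R)
    (lambda_dom a c h mu nu%:R) (lambda_fun a c h mu nu%:R).
  by apply: lambda_fun_power_series => //; lra.
have D0 x : lambda_dom a c h mu nu%:R x -> 0 < x by case.
split=> //; split; first exact: absolutely_monotonic_power_series S.
apply: multiplicatively_convex_power_series S => // x y.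
exact: lambda_dom_downward.
Qed.
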